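(* Let $R$ be a left and right noetherian ring and let $n$ be a non-negative integer. If every finitely generated left $R$-module has finite $\infty$-syzygy dimension at most $n$, then $\bigoplus_{i=0}^n I_i(R)$ is an injective cogenerator for the category of all left $R$-modules.
   Context: $\mathrm{mod}\,R$ is the category of finitely generated left $R$-modules. $M\in\mathrm{mod}\,R$ is an $m$-syzygy module if there is an exact sequence $0\to M\to P_{m-1}\to\cdots\to P_0\to A\to 0$ in $\mathrm{mod}\,R$ with every $P_i$ projective; $M$ is an $\infty$-syzygy module if it is an $m$-syzygy module for every $m\geq 1$. The $\infty$-syzygy dimension of $M\in\mathrm{mod}\,R$ is $\inf\{m\geq 0 : \text{there is an exact sequence } 0\to X_m\to\cdots\to X_1\to X_0\to M\to 0 \text{ in } \mathrm{mod}\,R \text{ with every } X_i \text{ an } \infty\text{-syzygy module}\}$, and is infinity if no such $m$ exists. $I_i(R)$ is the $(i+1)$-th term of the minimal injective resolution $0\to R\to I_0(R)\to I_1(R)\to\cdots$ of $R$ as a left $R$-module. An injective cogenerator is an injective module $X$ such that every left $R$-module embeds in a direct product of copies of $X$. *)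

(* Defs.v *)
From HB Require Import structures.
From mathcomp Require Import all_boot all_order all_algebra.
From mathcomp Require Import boolp classical_sets functions.

Set Implicit Arguments.
Unset Strict Implicit.
Unset Printing Implicit Defensive.

Import GRing.Theory.
Local Open Scope ring_scope.

(* Rings are associative and unital (pzRingType: the zero ring is allowed), not
   necessarily commutative; lmodType R is the type of left R-modules. *)

Section Modules.
Variable R : pzRingType.
Implicit Types M N : lmodType R.

(* Meant for S a submodule.  Subsets are boolean predicates: by excluded middle
   every subset of M is of this form. *)
Definition fg_submodule M (S : {pred M}) : Prop :=
  exists (k : nat) (g : 'I_k -> M),
    (forall i, g i \in S) /\
    (forall x, x \in S -> exists c : 'I_k -> R, x = \sum_(i < k) c i *: g i).

Definition finitely_generated M : Prop := fg_submodule (predT : {pred M}).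

Definition surjective M N (f : M -> N) : Prop := forall y, exists x, f x = y.

(* Exactness at N of L -f-> N -g-> M. *)
Definition exact_at (L N M : lmodType R) (f : L -> N) (g : N -> M) : Prop :=
  forall y, g y = 0 <-> exists x, f x = y.

Definition projective_module (P : lmodType R) : Prop :=
  forall (A B : lmodType R) (g : {linear A -> B}) (f : {linear P -> B}),
    surjective g -> exists h : {linear P -> A}, forall x, g (h x) = f x.

Definition injective_module (E : lmodType R) : Prop :=
  forall (A B : lmodType R) (g : {linear A -> B}) (f : {linear A -> E}),
    injective g -> exists h : {linear B -> E}, forall x, h (g x) = f x.

(* 0 -> C (k+1) -> C k -> ... -> C 1 -> C 0 -> 0 is exact; the terms of C
   beyond index k+1 are irrelevant. *)
Definition exact_sequence (k : nat) (C : nat -> lmodType R)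
    (d : forall i, {linear C i.+1 -> C i}) : Prop :=
  [/\ surjective (d 0%N),
      forall i, (i < k)%N -> exact_at (d i.+1) (d i)
    & injective (d k)].

(* The sequence is 0 -> M = C (m+1) -> C m -> ... -> C 1 -> C 0 -> 0, with
   P_i = C (i+1) and A = C 0. *)
Definition syzygy_module (m : nat) M : Prop :=
  exists (C : nat -> lmodType R) (d : forall i, {linear C i.+1 -> C i}),
    [/\ C m.+1 = M,
        exact_sequence m d,
        forall i, (i <= m.+1)%N -> finitely_generated (C i)
      & forall i, (i < m)%N -> projective_module (C i.+1)].

Definition infty_syzygy_module M : Prop :=
  forall m, (1 <= m)%N -> syzygy_module m M.

(* The sequence is 0 -> C (m+1) -> ... -> C 1 -> C 0 = M -> 0, with
   X_i = C (i+1). *)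
Definition has_infty_syzygy_resolution (m : nat) M : Prop :=
  exists (C : nat -> lmodType R) (d : forall i, {linear C i.+1 -> C i}),
    [/\ C 0%N = M,
        exact_sequence m d,
        forall i, (i <= m.+1)%N -> finitely_generated (C i)
      & forall i, (i <= m)%N -> infty_syzygy_module (C i.+1)].

(* None stands for infinity. *)
Definition infty_syzygy_dim M : option nat :=
  if pselect (exists m, `[< has_infty_syzygy_resolution m M >]) is left ex
  then Some (ex_minn ex) else None.

(* The image of f is an essential submodule of its codomain: it meets every
   nonzero submodule of N nontrivially. *)
Definition essential_image M N (f : M -> N) : Prop :=
  forall S : {pred N}, submod_closed S ->
    (exists2 y, y \in S & y != 0) -> exists2 x, f x \in S & f x != 0.

(* 0 -> R -e-> I 0 -d 0-> I 1 -d 1-> I 2 -> ... is exact with injective terms,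
   I 0 is an injective envelope of R, and I (i+1) is one of the cokernel of the
   map into I i, which is identified by exactness with the image of d i. *)
Definition minimal_injective_resolution (I : nat -> lmodType R)
    (e : {linear R^o -> I 0%N}) (d : forall i, {linear I i -> I i.+1}) : Prop :=
  [/\ forall i, injective_module (I i),
      injective e,
      exact_at e (d 0%N) /\ forall i, exact_at (d i) (d i.+1)
    & essential_image e /\ forall i, essential_image (d i)].

(* I 0 (+) ... (+) I n, as an iterated binary product. *)
Fixpoint direct_sum (I : nat -> lmodType R) (n : nat) : lmodType R :=
  if n is k.+1 then (direct_sum I k * I k.+1)%type else I 0%N.

(* J -> X, with pointwise operations, is the direct product of copies of X
   indexed by J. *)
Definition injective_cogenerator (X : lmodType R) : Prop :=
  injective_module X /\
  forall M, exists (J : Type) (f : {linear M -> (J -> X)}), injective f.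

End Modules.

Definition left_noetherian (R : pzRingType) : Prop :=
  forall S : {pred R^o}, submod_closed S -> fg_submodule S.

(* R^c is the opposite ring: its left ideals are the right ideals of R. *)
Definition right_noetherian (R : pzRingType) : Prop := left_noetherian R^c.

(* Main.v *)
Require Import Defs.
From HB Require Import structures.
From mathcomp Require Import all_boot all_order all_algebra.
From mathcomp Require Import boolp classical_sets functions.
Import GRing.Theory.
Local Open Scope ring_scope.

Set Implicit Arguments.
Unset Strict Implicit.
Unset Printing Implicit Defensive.

(** Write [E] for [I 0 (+) ... (+) I n].  It is injective as a finite product,
    and an injective module is a cogenerator as soon as every nonzero finitely
    generated module has a nonzero map into it: a nonzero [x] generates a
    cyclic submodule, a nonzero map on [Rx] is nonzero at [x], and it extends
    to the whole module ([injective_cogenerator_of_fg]).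

    So let [M] be finitely generated with [Hom(M, I j) = 0] for [j <= n]; the
    point is that [M = 0].  This is dimension shifting for [Ext^i(M, -)].
    - Along [0 -> R -> I 0 -> I 1 -> ...], where [Ext^i(M, I j) = 0] for every
      [i] when [j <= n], one gets [Ext^i(M, R) = 0] for [i <= n]
      ([Ext_vanishes_coresolution]), hence [Ext^i(M, P) = 0] for [P] finitely
      generated projective ([Ext_vanishes_projective]).
    - If [Y] is an [(i+1)]-syzygy module with [i <= n], shifting along
      [0 -> Y -> P_i -> ... -> P_0] gives [Ext^i(M, Y) = 0], the start being
      [Hom(M, -) = 0] on submodules of [P_0] ([Ext_vanishes_syzygy]).
    - Take [0 -> X_m -> ... -> X_0 -> M -> 0] with [m <= n] and every [X_i] an
      infinite syzygy.  Then [Ext^i(M, X_i) = 0] for all [i <= m], and shifting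
      from left to right gives [Hom(M, M) = 0] ([Ext_vanishes_right_end]), so
      the identity of [M] is zero.

    [Ext] is computed from a free resolution of [M]; only the vanishing of its
    cohomology groups is ever used, so no quotient group is formed. *)

(** * Submodules, images and factorizations *)

Section Modules.
Variable R : pzRingType.
Implicit Types A B C D E M N P X Y : lmodType R.

Definition linear_of A B (f : A -> B) (fl : linear f) : {linear A -> B} :=
  HB.pack f (GRing.isLinear.Build _ _ _ _ f fl).

Section Submodule.
Variables (M : lmodType R) (S : {pred M}).
Hypothesis hS : submod_closed S.

(** The proof [hS] is an argument of the carrier so that the module structure,
    which depends on it, can be found from the type. *)
Definition sub_carrier of submod_closed S := {x : M | x \in S}.
HB.instance Definition _ := GRing.isSubmodClosed.Build R M S hS.
HB.instance Definition _ :=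
  [isSub of sub_carrier hS for (@sval M (fun x => x \in S))].
HB.instance Definition _ := [Choice of sub_carrier hS by <:].
HB.instance Definition _ :=
  GRing.SubChoice_isSubLmodule.Build R M S (sub_carrier hS)
    (GRing.submod_closed_semi hS).

Lemma submodule_carrier :
  exists (N : lmodType R) (inc : {linear N -> M}),
    injective inc /\ forall y, y \in S <-> exists x, inc x = y.
Proof.
exists (sub_carrier hS : lmodType R), (val : {linear _ -> _}); split; first exact: val_inj.
move=> y; split=> [yS|[x <-]]; last exact: valP.
by exists (exist _ y yS : sub_carrier hS).
Qed.

End Submodule.

Lemma lift_injective A B N (i : {linear A -> B}) (f : {linear N -> B}) :
  injective i -> (forall x, exists a, i a = f x) ->
  exists h : {linear N -> A}, forall x, i (h x) = f x.
Proof.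
move=> inj /choice [h hE].
have hl : linear h.
  by move=> a x y; apply: inj; rewrite linearP !hE linearP.
by exists (linear_of hl).
Qed.

Lemma descend_surjective A B N (p : {linear A -> B}) (f : {linear A -> N}) :
  surjective p -> (forall x, p x = 0 -> f x = 0) ->
  exists h : {linear B -> N}, forall x, h (p x) = f x.
Proof.
move=> /choice [s sE] ker.
have fE x y : p x = p y -> f x = f y.
  by move=> e; apply/eqP; rewrite -subr_eq0 -linearB ker // linearB e subrr.
have hl : linear (f \o s).
  by move=> a x y /=; rewrite -linearP; apply: fE; rewrite linearP !sE.
by exists (linear_of hl) => x /=; apply: fE; rewrite sE.
Qed.

Lemma image_factorization A B (f : {linear A -> B}) :
  exists (K : lmodType R) (p : {linear A -> K}) (i : {linear K -> B}),
    [/\ surjective p, injective i & forall x, i (p x) = f x].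
Proof.
pose S : {pred B} := [pred y | `[< exists x, f x = y >]].
have SP y : y \in S <-> exists x, f x = y by split=> [/asboolP|h] //; apply/asboolP.
have hS : submod_closed S.
  split; first by apply/SP; exists 0; rewrite linear0.
  move=> a _ _ /SP[x <-] /SP[y <-]; apply/SP.
  by exists (a *: x + y); rewrite linearP.
have [K [i [inj iS]]] := submodule_carrier hS.
have [x|p pE] := @lift_injective _ _ _ i f inj.
  by apply/iS/SP; exists x.
exists K, p, i; split=> // k.
have /iS/SP[x xE] : exists k', i k' = i k by exists k.
by exists x; apply: inj; rewrite pE.
Qed.

(** Injectivity without an embedding: [f] descends to the image of [d], which
    is a submodule of [B]. *)
Lemma injective_extension E A B (d : {linear A -> B}) (f : {linear A -> E}) :
  injective_module E -> (forall x, d x = 0 -> f x = 0) ->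
  exists h : {linear B -> E}, forall x, h (d x) = f x.
Proof.
move=> injE ker.
have [K [p [i [sp ii pi]]]] := image_factorization d.
have [x px0|f' f'E] := @descend_surjective _ _ _ p f sp.
  by apply: ker; rewrite -pi px0 linear0.
have [h hE] := injE _ _ i f' ii.
by exists h => x; rewrite -pi hE f'E.
Qed.

(** * Free modules and projective resolutions *)

Definition supported N (v : N -> R^o) (s : seq N) :=
  uniq s /\ forall x, x \notin s -> v x = 0.

(** Outside the support the summands vanish, so a linear combination may be
    summed over any finite list that carries the coefficients. *)
Lemma supported_sum N Y (h : N -> Y) v s t : supported v s -> supported v t ->
  \sum_(x <- s) (v x : R) *: h x = \sum_(x <- t) (v x : R) *: h x.
Proof.
have red r : \sum_(x <- r) (v x : R) *: h x
    = \sum_(x <- [seq x <- r | v x != 0]) (v x : R) *: h x.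
  rewrite big_filter [RHS]big_mkcond; apply: eq_bigr => x _.
  by case: eqP => [->|//]; rewrite scale0r.
move=> [us s0] [ut t0]; rewrite red [RHS]red; apply: perm_big.
apply: uniq_perm; rewrite ?filter_uniq // => x; rewrite !mem_filter.
case: eqP => //= /eqP vx.
have -> : x \in s by apply: contraNT vx => /s0/eqP.
by apply/esym; apply: contraNT vx => /t0/eqP.
Qed.

(** The free module on the set of elements of [N], realized by the finitely
    supported functions [N -> R], with the delta functions as the basis [b]. *)
Lemma free_module N : exists (F : lmodType R) (b : N -> F),
  (forall Y (h : N -> Y), exists g : {linear F -> Y}, forall x, g (b x) = h x) /\
  (forall Y (g g' : {linear F -> Y}),
     (forall x, g (b x) = g' (b x)) -> forall v, g v = g' v).
Proof.
pose S : {pred (N -> R^o)} := [pred v | `[< exists s, supported v s >]].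
have SP v : v \in S <-> exists s, supported v s
    by split=> [/asboolP|h] //; apply/asboolP.
have big_supp (u v : N -> R^o) s t : supported u s -> supported v t ->
    supported u (undup (s ++ t)) /\ supported v (undup (s ++ t)).
  move=> [us s0] [ut t0]; split; split; rewrite ?undup_uniq // => x;
  by rewrite mem_undup mem_cat negb_or => /andP[? ?]; auto.
have comb (u v : N -> R^o) s a : supported u s -> supported v s ->
    supported (a *: u + v : N -> R^o) s.
  move=> [us s0] [_ t0]; split=> // x xs.
  have -> : (a *: u + v : N -> R^o) x = a * u x + v x by [].
  by rewrite s0 // t0 // mulr0 addr0.
have hS : submod_closed S.
  split; first by apply/SP; exists [::].
  move=> a u v /SP[s us] /SP[t vt]; apply/SP.
  have [us' vt'] := big_supp _ _ _ _ us vt.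
  by exists (undup (s ++ t)); apply: comb.
have [F [inc [inj incS]]] := submodule_carrier hS.
have /choice[supp suppP] v : exists s, supported (inc v) s.
  by apply/SP/incS; exists v.
pose delta (x : N) : N -> R^o := fun y => (y == x)%:R.
have deltaP x : supported (delta x) [:: x].
  by split=> // y; rewrite inE /delta => /negbTE->.
have /choice[b bE] x : exists y, inc y = delta x.
  by apply/incS/SP; exists [:: x].
exists F, b; split.
  move=> Y h; pose g v := \sum_(x <- supp v) (inc v x : R) *: h x.
  have gE v s : supported (inc v) s -> g v = \sum_(x <- s) (inc v x : R) *: h x.
    by move=> vs; apply: supported_sum.
  have gl : linear g.
    move=> a u v; have [us vs] := big_supp _ _ _ _ (suppP u) (suppP v).
    rewrite (gE u _ us) (gE v _ vs) (gE _ (undup (supp u ++ supp v))); last first.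
      by rewrite linearP; apply: comb.
    rewrite scaler_sumr -big_split; apply: eq_bigr => x _.
    by rewrite linearP fctE scalerDl scalerA.
  exists (linear_of gl) => x; rewrite /= (gE _ [:: x]) bE //.
  by rewrite big_seq1 /delta eqxx scale1r.
move=> Y g g' gg' v.
have -> : v = \sum_(x <- supp v) (inc v x : R) *: b x.
  apply: inj; rewrite linear_sum; apply/funext => y.
  have [us s0] := suppP v.
  have evE x : inc ((inc v x : R) *: b x) y = (inc v x : R) * (y == x)%:R.
    by rewrite linearZ bE.
  rewrite fct_sumE (eq_bigr _ (fun x _ => evE x)).
  have [ys|ys] := boolP (y \in supp v).
    rewrite (bigD1_seq y) //= eqxx mulr1 big1 ?addr0 // => x xy.
    by rewrite eq_sym (negbTE xy) mulr0.
  rewrite s0 // big1_seq // => x /= xs.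
  by case: eqP => [yx|]; [rewrite yx xs in ys | rewrite mulr0].
by rewrite !linear_sum; apply: eq_bigr => x _; rewrite !linearZ /= gg'.
Qed.

(** Sending the basis vector of [x] to [x] when [phi x = 0], and to [0]
    otherwise, covers exactly the kernel of [phi]. *)
Lemma projective_exact_cover N N' (phi : {linear N -> N'}) :
  exists (P : lmodType R) (d : {linear P -> N}), projective_module P /\ exact_at d phi.
Proof.
have [P [b [ext uni]]] := free_module N.
have [d dE] := ext _ (fun x => if phi x == 0 then x else 0).
exists P, d; split.
  move=> A B g f /choice[s sE].
  have [h hE] := ext _ (s \o f \o b).
  exists h => x; apply: (uni _ (g \o h : {linear _ -> _}) f) => y /=.
  by rewrite hE sE.
move=> y; split=> [y0|[x <-]]; first by exists (b y); rewrite dE y0 eqxx.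
apply: (uni _ (phi \o d : {linear _ -> _}) \0) => z /=.
by rewrite dE; case: eqP => //; rewrite linear0.
Qed.

Definition zero_module : lmodType R := 'I_0 -> R^o.

Lemma zero_moduleE (x : zero_module) : x = 0.
Proof. by apply/funext => -[]. Qed.

(** The state of the recursion that builds a resolution: the last map found. *)
Record arrow := Arrow {
  source : lmodType R; target : lmodType R; map_of : {linear source -> target} }.

(** Encodes [... -> P_1 -> P_0 -> 0], a projective resolution of [M] without
    [M] itself, with [F 0 = 0] and [F i.+1 = P_i].  Starting with the zero
    module makes degree 0 an instance of the general definition of [Ext]:
    a coboundary in degree 0 is a map that factors through zero. *)
Definition deleted_resolution M (F : nat -> lmodType R)
    (d : forall i, {linear F i.+1 -> F i}) :=
  [/\ forall x : F 0, x = 0, forall i, projective_module (F i),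
      forall i, exact_at (d i.+2) (d i.+1)
    & exists2 aug : {linear F 1 -> M}, surjective aug & exact_at (d 1) aug].

Lemma deleted_resolution_exists M :
  exists (F : nat -> lmodType R) (d : forall i, {linear F i.+1 -> F i}),
    deleted_resolution M d.
Proof.
have cover (t : arrow) : {P : lmodType R & {d : {linear P -> source t} |
    projective_module P /\ exact_at d (map_of t)}}.
  have /cid[P /cid[d dP]] := projective_exact_cover (map_of t).
  by exists P, d.
pose next t := Arrow (proj1_sig (projT2 (cover t))).
pose t0 := Arrow (\0 : {linear M -> zero_module}).
(* [G] is the augmented resolution, with [M] in degree 0; [F] replaces [M]
   by zero. *)
pose G i := source (iter i next t0).
pose dG i : {linear G i.+1 -> G i} := map_of (iter i.+1 next t0).
have dGP i : projective_module (G i.+1) /\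
    exact_at (dG i) (map_of (iter i next t0)).
  exact: proj2_sig (projT2 (cover (iter i next t0))).
pose F i := if i is j.+1 then G j.+1 else zero_module.
pose d i : {linear F i.+1 -> F i} :=
  match i return {linear F i.+1 -> F i} with
  | 0 => \0 | j.+1 => dG j.+1 end.
exists F, d; split.
- exact: zero_moduleE.
- case=> [|i]; last by case: (dGP i).
  move=> A B g f _; exists \0 => x /=.
  by rewrite (zero_moduleE x) !linear0.
- by move=> i; case: (dGP i.+2).
- exists (dG 0%N).
    move=> y; have [_ ex] := dGP 0%N.
    by apply/ex.
  by case: (dGP 1%N).
Qed.

(** * Cutting an exact sequence at its right end *)

Definition cut_terms (K : lmodType R) (C : nat -> lmodType R) i : lmodType R :=
  if i is j.+1 then C j.+2 else K.

Definition cut_maps (K : lmodType R) (C : nat -> lmodType R)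
    (p : {linear C 2 -> K}) (c : forall i, {linear C i.+1 -> C i}) i :
    {linear cut_terms K C i.+1 -> cut_terms K C i} :=
  if i is j.+1 then c j.+2 else p.

(** The inductive step of every dimension shift along an exact sequence.  The
    module [K] is the image of [C 2 -> C 1], that is, the kernel of
    [C 1 -> C 0]. *)
Lemma exact_sequence_split m (C : nat -> lmodType R)
    (c : forall i, {linear C i.+1 -> C i}) :
  exact_sequence m.+1 c ->
  exists (K : lmodType R) (u : {linear K -> C 1%N}) (p : {linear C 2 -> K}),
    [/\ injective u, exact_at u (c 0%N) &
      exact_sequence m (cut_maps p c)].
Proof.
move=> [c0 ex inj].
have [K [p [u [sp iu pu]]]] := image_factorization (c 1%N).
have p0 x : p x = 0 <-> c 1%N x = 0.
  by rewrite -pu; split=> [->|e]; [rewrite linear0 | apply: iu; rewrite e linear0].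
exists K, u, p; split=> //.
  move=> y; split=> [/(ex 0%N isT)[x <-]|[k <-]]; first by exists (p x); rewrite pu.
  by have [x <-] := sp k; apply/(ex 0%N isT); exists x; rewrite pu.
split=> //.
- case=> [|i] im y; last exact: (ex i.+2).
  by rewrite p0; apply: (ex 1%N).
- case: m ex inj => [|m] // _ inj x y /= e; apply: inj.
  by rewrite -!pu e.
Qed.

(** * Vanishing of Ext and dimension shifting *)

Section Cohomology.
Variables (M : lmodType R) (F : nat -> lmodType R).
Variable d : forall i, {linear F i.+1 -> F i}.
Hypothesis resF : deleted_resolution M d.

(** [Ext^i(M, Y) = 0], as vanishing of the cohomology of [Hom(P_i, Y)]; the
    degrees are shifted because [P_i] is [F i.+1]. *)
Definition Ext_vanishes i Y := forall f : {linear F i.+1 -> Y},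
  (forall x, f (d i.+1 x) = 0) ->
  exists g : {linear F i -> Y}, forall x, g (d i x) = f x.

Lemma differential_comp0 i x : d i (d i.+1 x) = 0.
Proof.
case: resF => F0 _ ex _; case: i x => [|i] x; first exact: F0.
by apply/ex; exists x.
Qed.

Section ShortExact.
Variables (A B C : lmodType R) (u : {linear A -> B}) (v : {linear B -> C}).
Hypotheses (uinj : injective u) (uv : exact_at u v) (vsurj : surjective v).

(** [Hom(M, A)] embeds in [Hom(M, B)]. *)
Lemma Ext_vanishes_sub0 : Ext_vanishes 0 B -> Ext_vanishes 0 A.
Proof.
have [F0 _ _ _] := resF; move=> vB f fd.
have [x|g gE] := vB (u \o f : {linear _ -> _}); first by rewrite /= fd linear0.
exists \0 => x; apply: uinj; have /= <- := gE x.
by rewrite (F0 (d 0 x)) !linear0.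
Qed.

(** Exactness of [Ext^i(M, C) -> Ext^(i+1)(M, A) -> Ext^(i+1)(M, B)], by a
    diagram chase. *)
Lemma Ext_vanishes_sub i :
  Ext_vanishes i C -> Ext_vanishes i.+1 B -> Ext_vanishes i.+1 A.
Proof.
have [_ proj _ _] := resF.
move=> vC vB f fd.
have [x|g gE] := vB (u \o f : {linear _ -> _}); first by rewrite /= fd linear0.
have [x|h hE] := vC (v \o g : {linear _ -> _}).
  by rewrite /= gE; apply/uv; exists (f x).
(* Correct the cobounding map [g] by a coboundary so that it lands in [A]. *)
have [h' h'E] := proj i _ _ v h vsurj.
have [x|k kE] := @lift_injective _ _ _ u (g \- (h' \o d i) : {linear _ -> _}) uinj.
  by apply/uv; rewrite linearB /= h'E hE subrr.
exists k => x; apply: uinj; rewrite kE /= differential_comp0 linear0 subr0.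
exact: gE.
Qed.

(** Exactness of [Ext^i(M, B) -> Ext^i(M, C) -> Ext^(i+1)(M, A)]. *)
Lemma Ext_vanishes_quotient i :
  Ext_vanishes i B -> Ext_vanishes i.+1 A -> Ext_vanishes i C.
Proof.
have [_ proj _ _] := resF.
move=> vB vA f fd.
(* Lift the cocycle [f] to [B]; the defect of the lift is a cocycle in [A]. *)
have [f' f'E] := proj i.+1 _ _ v f vsurj.
have [x|k kE] := @lift_injective _ _ _ u (f' \o d i.+1 : {linear _ -> _}) uinj.
  by apply/uv; rewrite /= f'E fd.
have [x|g gE] := vA k.
  by apply: uinj; rewrite kE /= differential_comp0 !linear0.
have [x|h hE] := vB (f' \- (u \o g) : {linear _ -> _}).
  by rewrite /= gE kE subrr.
exists (v \o h) => x /=; rewrite hE linearB /= f'E.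
by have -> : v (u (g x)) = 0 by [apply/uv; exists (g x)]; rewrite subr0.
Qed.

End ShortExact.

(** Shifting from the right end [C 0] to the left end raises the degree by one
    at each of the [m] terms passed. *)
Lemma Ext_vanishes_left_end m j (C : nat -> lmodType R)
    (c : forall i, {linear C i.+1 -> C i}) :
  exact_sequence m c -> Ext_vanishes j (C 0%N) ->
  (forall k, (k < m)%N -> Ext_vanishes (j + k).+1 (C k.+1)) ->
  Ext_vanishes (j + m) (C m.+1).
Proof.
elim: m j C c => [|m IH] j C c exC v0 vC.
  rewrite addn0 => f fd; case: exC => c0 _ inj.
  have [x|g gE] := v0 (c 0%N \o f : {linear _ -> _}); first by rewrite /= fd linear0.
  have [x|h hE] := @lift_injective _ _ _ (c 0%N) g inj; first exact: c0.
  by exists h => x; apply: inj; rewrite hE gE.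
have [K [u [p [iu uc exK]]]] := exact_sequence_split exC.
rewrite -addSnnS.
apply: (IH _ _ _ exK) => [|k km] /=.
  apply: (Ext_vanishes_sub iu uc) v0 _; first by case: exC.
  by have := vC 0%N isT; rewrite addn0.
by have := vC k.+1 km; rewrite addnS.
Qed.

(** The first cut turns [Y] into the left end of a sequence of length [m] whose
    right end is a submodule of the projective module [C 1], so that
    [Hom(M, -)] vanishes there because [Hom(M, C 1)] does; then shift
    leftwards. *)
Lemma Ext_vanishes_syzygy m Y :
  (forall i P, (i <= m)%N -> finitely_generated P -> projective_module P ->
     Ext_vanishes i P) ->
  syzygy_module m.+1 Y -> Ext_vanishes m Y.
Proof.
move=> vP [C [c [<- exC fgC prC]]].
have [K [u [p [iu uc exK]]]] := exact_sequence_split exC.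
have vC k : (k <= m)%N -> Ext_vanishes k (C k.+1).
  move=> km; apply: vP => //; last exact: prC.
  by apply: fgC; rewrite ltnS ltnW.
apply: (Ext_vanishes_left_end (j := 0) exK) => [|k km] /=.
  exact: Ext_vanishes_sub0 iu (vC 0%N isT).
exact: vC.
Qed.

(** The reverse shift: the vanishing at the inner terms makes the connecting
    maps from [Ext^j(M, C 0)] to [Ext^(j+m)(M, C m.+1)] injective. *)
Lemma Ext_vanishes_right_end m j (C : nat -> lmodType R)
    (c : forall i, {linear C i.+1 -> C i}) :
  exact_sequence m c ->
  (forall k, (k <= m)%N -> Ext_vanishes (j + k) (C k.+1)) ->
  Ext_vanishes j (C 0%N).
Proof.
elim: m j C c => [|m IH] j C c exC vC.
  case: exC => c0 _ inj f fd.
  have [x|h hE] := @lift_injective _ _ _ (c 0%N) f inj; first exact: c0.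
  have := vC 0%N isT; rewrite addn0 => /(_ h) [x|g gE].
    by apply: inj; rewrite hE fd linear0.
  by exists (c 0%N \o g) => x; rewrite /= gE hE.
have [K [u [p [iu uc exK]]]] := exact_sequence_split exC.
apply: (Ext_vanishes_quotient iu uc); first by case: exC.
  by have := vC 0%N isT; rewrite addn0.
apply: (IH _ _ _ exK) => k km; have := vC k.+1 km.
by rewrite addnS addSn.
Qed.

(** In degree 0 a cocycle factors through [M] because [E] is injective, and
    so vanishes; in higher degrees [Hom(-, E)] preserves the exactness of the
    resolution. *)
Lemma Ext_vanishes_injective E i : injective_module E ->
  (forall g : {linear M -> E}, forall x, g x = 0) -> Ext_vanishes i E.
Proof.
have [F0 _ ex [aug _ exaug]] := resF.
move=> injE hom0 f fd; case: i f fd => [|i] f fd.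
  exists \0 => x /=.
  have [y|g gE] := @injective_extension E _ _ aug f injE.
    by move=> /exaug[z <-].
  by rewrite -gE hom0.
by apply: injective_extension => // x /ex[y <-].
Qed.

(** Dimension shifting along a coresolution, by induction on the degree: the
    image of [I 0 -> I 1] has a coresolution starting at [I 1]. *)
Lemma Ext_vanishes_coresolution n Y (I : nat -> lmodType R)
    (e : {linear Y -> I 0%N}) (c : forall i, {linear I i -> I i.+1}) :
  injective e -> exact_at e (c 0%N) -> (forall i, exact_at (c i) (c i.+1)) ->
  (forall i j, (j <= n)%N -> Ext_vanishes i (I j)) ->
  Ext_vanishes n Y.
Proof.
elim: n Y I e c => [|n IH] Y I e c ie ec exc vI.
  exact: Ext_vanishes_sub0 ie (vI 0%N 0%N isT).
have [K [p [u [sp iu pu]]]] := image_factorization (c 0%N).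
apply: (Ext_vanishes_sub (v := p) ie) => //.
- move=> y; rewrite -ec -pu.
  by split=> [->|h]; [rewrite linear0 | apply: iu; rewrite h linear0].
- apply: (IH K (fun i => I i.+1) u (fun i => c i.+1)) => //.
    move=> y; rewrite (exc 0%N y); split=> [[x <-]|[k <-]].
      by exists (p x).
    by have [x <-] := sp k; exists x; rewrite pu.
  by move=> i j jn; apply: vI.
- exact: vI.
Qed.

(** [P] is a direct summand of [R^k], by projectivity, so that a cocycle with
    values in [P] is given by [k] cocycles with values in [R]. *)
Lemma Ext_vanishes_projective i P : Ext_vanishes i R^o ->
  finitely_generated P -> projective_module P -> Ext_vanishes i P.
Proof.
move=> vR [k [g [_ gen]]] projP f fd.
have pil : linear (fun c : 'I_k -> R^o => \sum_(l < k) (c l : R) *: g l).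
  move=> a x y; rewrite scaler_sumr -big_split; apply: eq_bigr => l _.
  by rewrite fctE scalerDl scalerA.
have [y|s sE] := projP _ _ (linear_of pil) (@idfun P : {linear P -> P}).
  by have [c ->] := gen y isT; exists c.
have evl (l : 'I_k) : linear (fun c : 'I_k -> R^o => c l) by [].
have /choice[h hE] l : exists h : {linear F i -> R^o}, forall x, h (d i x) = s (f x) l.
  have [x|h hE] := vR (linear_of (evl l) \o s \o f : {linear _ -> _}).
    by rewrite /= fd linear0.
  by exists h.
have gl : linear (fun x => \sum_(l < k) (h l x : R) *: g l).
  move=> a x y; rewrite scaler_sumr -big_split; apply: eq_bigr => l _.
  by rewrite linearP scalerDl scalerA.
exists (linear_of gl) => x; rewrite -[RHS](sE (f x)) /=.
by apply: eq_bigr => l _; rewrite hE.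
Qed.

(** The augmentation is the cocycle that represents the identity of [M]. *)
Lemma Ext0_self_vanishes_eq0 : Ext_vanishes 0 M -> forall x : M, x = 0.
Proof.
have [F0 _ _ [aug saug exaug]] := resF.
move=> /(_ aug) [x|g gE x]; first by apply/exaug; exists x.
by have [y <-] := saug x; rewrite -gE (F0 (d 0 y)) linear0.
Qed.

End Cohomology.

(** * Modules without maps to an injective resolution of R *)

Lemma infty_syzygy_dimP M m : infty_syzygy_dim M = Some m ->
  has_infty_syzygy_resolution m M.
Proof.
rewrite /infty_syzygy_dim; case: pselect => // ex [<-].
by case: ex_minnP => k /asboolP.
Qed.

Lemma Hom_coresolution_eq0 n m M (I : nat -> lmodType R)
    (e : {linear R^o -> I 0%N}) (c : forall i, {linear I i -> I i.+1}) :
  (m <= n)%N -> has_infty_syzygy_resolution m M ->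
  (forall i, injective_module (I i)) -> injective e ->
  exact_at e (c 0%N) -> (forall i, exact_at (c i) (c i.+1)) ->
  (forall j, (j <= n)%N -> forall (g : {linear M -> I j}) x, g x = 0) ->
  forall x : M, x = 0.
Proof.
move=> mn [C [b [C0 exC fgC syzC]]] injI ie ec exc hom0.
have [F [d resF]] := deleted_resolution_exists M.
have vR i : (i < n.+1)%N -> Ext_vanishes d i R^o.
  move=> ilen; apply: (Ext_vanishes_coresolution resF ie ec exc) => k j ji.
  by apply: (Ext_vanishes_injective resF) => //; apply: hom0; rewrite (leq_trans ji).
apply: (Ext0_self_vanishes_eq0 resF).
rewrite -C0; apply: (Ext_vanishes_right_end resF exC) => k km.
apply: (Ext_vanishes_syzygy resF); last exact: (syzC k km).
move=> i P ik; apply: Ext_vanishes_projective; apply: vR.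
by rewrite ltnS (leq_trans ik) // (leq_trans km).
Qed.

(** * Cogenerators *)

Lemma direct_sum_injective (I : nat -> lmodType R) n :
  (forall i, injective_module (I i)) -> injective_module (direct_sum I n).
Proof.
move=> injI; elim: n => [|n IH]; first exact: injI.
move=> A B g f ig.
have [h1 h1E] := IH _ _ g (fst \o f : {linear _ -> _}) ig.
have [h2 h2E] := injI n.+1 _ _ g (snd \o f : {linear _ -> _}) ig.
have hl : linear (fun x => (h1 x, h2 x) : direct_sum I n.+1).
  by move=> a x y; rewrite !linearP.
exists (linear_of hl) => x; rewrite /= h1E h2E /=.
by case: (f x).
Qed.

Lemma direct_sum_inj (I : nat -> lmodType R) n j : (j <= n)%N ->
  exists u : {linear I j -> direct_sum I n}, injective u.
Proof.
elim: n => [|n IH].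
  by rewrite leqn0 => /eqP->; exists idfun.
rewrite leq_eqVlt => /orP[/eqP->|/IH[u iu]].
  have ul : linear (fun x => (0, x) : direct_sum I n.+1).
    move=> a x y.
    by rewrite -{1}[0](addr0 (0 : direct_sum I n)) -{1}(scaler0 (direct_sum I n) a).
  by exists (linear_of ul) => x y [].
have ul : linear (fun x => (u x, 0) : direct_sum I n.+1).
  move=> a x y; rewrite linearP.
  by rewrite -{1}[0](addr0 (0 : I n.+1)) -{1}(scaler0 (I n.+1) a).
by exists (linear_of ul) => x y [] /iu.
Qed.

(** Evaluation embeds [M] in the power of [X] indexed by [Hom(M, X)]: if every
    map vanishes at [z], then none is nonzero on the cyclic module [Rz], since
    maps on [Rz] extend to [M]; so [Rz = 0]. *)
Lemma injective_cogenerator_of_fg X :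
  injective_module X ->
  (forall N, finitely_generated N ->
     (forall (g : {linear N -> X}) x, g x = 0) -> forall x : N, x = 0) ->
  injective_cogenerator X.
Proof.
move=> injX sep; split=> // M.
have fl : linear (fun (x : M) (g : {linear M -> X}) => g x).
  by move=> a x y; apply/funext => g; rewrite linearP.
exists {linear M -> X}, (linear_of fl); apply: raddf_inj => z /= z0.
have sl : linear (fun a : R^o => (a : R) *: z).
  by move=> a x y; rewrite scalerDl scalerA.
have [K [p [u [sp iu pu]]]] := image_factorization (linear_of sl).
have fgK : finitely_generated K.
  exists 1%N, (fun=> p 1); split=> // y _; have [a <-] := sp y.
  by exists (fun=> a); rewrite big_ord1 -linearZ /= /GRing.scale /= mulr1.
have p1 : p 1 = 0.
  apply: (sep K fgK) => k y; have [a <-] := sp y.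
  have [h hE] := injX _ _ u k iu.
  rewrite -hE pu /= linearZ /=.
  by have /= -> := congr1 (fun t => t h) z0; rewrite scaler0.
by rewrite -(scale1r z) -[LHS]pu p1 linear0.
Qed.

End Modules.

Unset Implicit Arguments.

Theorem corollary3p9 (R : pzRingType) (n : nat)
    (hl : left_noetherian R) (hr : right_noetherian R)
    (hdim : forall M : lmodType R, finitely_generated M ->
       exists2 m : nat, infty_syzygy_dim M = Some m & (m <= n)%N)
    (I : nat -> lmodType R) (e : {linear R^o -> I 0%N})
    (d : forall i : nat, {linear I i -> I i.+1})
    (hI : minimal_injective_resolution e d) :
  injective_cogenerator (direct_sum I n).
Proof.
have [injI ie [ed exd] _] := hI.
apply: injective_cogenerator_of_fg; first exact: direct_sum_injective.
move=> N /hdim[m /infty_syzygy_dimP resN mn] hom0.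
apply: (Hom_coresolution_eq0 mn resN injI ie ed exd) => j jn g x.
have [u iu] := direct_sum_inj I jn.
by apply: iu; rewrite linear0 -(hom0 (u \o g : {linear _ -> _}) x).
Qed.
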